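(* Let $(a_n)_{n\in\mathbb{N}}$ be a sequence of positive integers and fix $a\in\mathbb{N}$. For any $0\leq h\leq\log(a)$, the set $$T_h:=\{Y\in\mathcal{Z}(a_n)\colon\mathcal{L}_1(Y)\subseteq\{0,1,\dots,a-1\}\text{ and }h_{\mathrm{top}}(Y)\geq h\}$$ is a dense $G_{\delta}$ subset, with respect to the Hausdorff metric, of the space of all subshifts of $\{0,1,\dots,a-1\}^{\mathbb{Z}}$ that have topological entropy at least $h$.
   Context: A subshift (shift) is a non-empty closed $\sigma$-invariant subset $X$ of $\mathcal{A}^{\mathbb{Z}}$, $\mathcal{A}$ a finite alphabet, where $(\sigma x)_n=x_{n+1}$. $\mathcal{A}^{\mathbb{Z}}$ carries the metric $d((x_n),(y_n))=2^{-\inf\{|n|\colon x_n\neq y_n\}}$, and the Hausdorff metric is the induced one on closed subsets. $\mathcal{L}_n(X)$ is the set of words of length $n$ occurring in elements of $X$, and $h_{\mathrm{top}}(X)=\lim_n\frac1n\log|\mathcal{L}_n(X)|$. A minimal forbidden word of $X$ is a finite word over $\mathcal{A}$ that occurs in no element of $X$ but all of whose proper subwords occur in elements of $X$. $\mathcal{Z}(a_n)$ is the set of all shifts $(X,\sigma)$ such that, for infinitely many $n\in\mathbb{N}$, $X$ has no minimal forbidden words of length between $n$ and $n+a_n$ (inclusive). *)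

(* Defs.v *)
From HB Require Import structures.
From mathcomp Require Import all_boot all_order all_algebra.
From mathcomp Require Import all_classical all_reals all_analysis.
Set Implicit Arguments.
Unset Strict Implicit.
Unset Printing Implicit Defensive.
Import Order.TTheory GRing.Theory Num.Theory.
Import numFieldNormedType.Exports.
Local Open Scope classical_set_scope.
Local Open Scope ring_scope.

Section HausdorffDistance.
Context {R : realType} {T : metricType R}.
Implicit Types (x y : T) (X Y Z : set T).

Definition dist_to_set x Y : R := inf [set mdist x y | y in Y].

(* [sup] and [inf] are the usual ones only on nonempty bounded sets, so this is
   the Hausdorff distance for nonempty bounded [X] and [Y]. *)
Definition hausdorff_dist X Y : R :=
  Num.max (sup [set dist_to_set x Y | x in X])
          (sup [set dist_to_set y X | y in Y]).

Lemma dist_to_set_has_inf x Y : Y !=set0 ->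
  has_inf [set mdist x y | y in Y].
Proof.
move=> [y Yy]; split; first by exists (mdist x y), y.
by exists 0 => _ [z _ <-]; exact: mdist_ge0.
Qed.

Lemma dist_to_set_le x y Y : Y y -> dist_to_set x Y <= mdist x y.
Proof.
move=> Yy; apply: ge_inf; last by exists y.
by apply: (dist_to_set_has_inf x (ex_intro _ y Yy)).2.
Qed.

Lemma dist_to_set_ge0 x Y : Y !=set0 -> 0 <= dist_to_set x Y.
Proof.
move=> Y0; apply: lb_le_inf; first exact: (dist_to_set_has_inf x Y0).1.
by move=> _ [z _ <-]; exact: mdist_ge0.
Qed.

Section Bounded.
Variable C : R.
Hypothesis le_C : forall x y, mdist x y <= C.

Lemma hausdorff_has_sup X Y : X !=set0 -> Y !=set0 ->
  has_sup [set dist_to_set x Y | x in X].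
Proof.
move=> [x Xx] [y Yy]; split; first by exists (dist_to_set x Y), x.
exists C => _ [z _ <-]; exact: le_trans (dist_to_set_le _ Yy) (le_C _ _).
Qed.

Lemma hausdorff_dist_sym X Y : hausdorff_dist X Y = hausdorff_dist Y X.
Proof. by rewrite /hausdorff_dist maxC. Qed.

Lemma hausdorff_distP X Y e : X !=set0 -> Y !=set0 ->
  hausdorff_dist X Y <= e <->
  (forall x, X x -> dist_to_set x Y <= e) /\
  (forall y, Y y -> dist_to_set y X <= e).
Proof.
move=> X0 Y0.
have [XY0 XYb] := hausdorff_has_sup X0 Y0.
have [YX0 YXb] := hausdorff_has_sup Y0 X0.
rewrite /hausdorff_dist ge_max; split.
  move=> /andP[XYe YXe]; split=> [x Xx|y Yy].
    by apply: le_trans XYe; apply: ub_le_sup => //; exists x.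
  by apply: le_trans YXe; apply: ub_le_sup => //; exists y.
move=> [XYe YXe]; apply/andP; split; apply: ge_sup => // _ [x xP <-].
  exact: XYe.
exact: YXe.
Qed.

Lemma hausdorff_distxx X : X !=set0 -> hausdorff_dist X X = 0.
Proof.
move=> X0; apply/le_anti/andP; split.
  by apply/hausdorff_distP => //; split=> x Xx;
     rewrite -(mdistxx x) dist_to_set_le.
have [x Xx] := X0.
apply: le_trans (dist_to_set_ge0 x X0) _.
by have [/(_ _ Xx)] := (hausdorff_distP _ X0 X0).1 (lexx _).
Qed.

Lemma hausdorff_dist_triangle X Y Z : X !=set0 -> Y !=set0 -> Z !=set0 ->
  hausdorff_dist X Z <= hausdorff_dist X Y + hausdorff_dist Y Z.
Proof.
have half (A B D : set T) : A !=set0 -> B !=set0 -> D !=set0 ->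
    forall x, A x -> dist_to_set x D <= hausdorff_dist A B + hausdorff_dist B D.
  move=> A0 B0 D0 x Ax.
  have [/(_ _ Ax) xB _] := (hausdorff_distP _ A0 B0).1 (lexx _).
  have [BD _] := (hausdorff_distP _ B0 D0).1 (lexx _).
  rewrite -lerBlDr; apply: le_trans xB.
  apply: lb_le_inf; first exact: (dist_to_set_has_inf x B0).1.
  move=> _ [y By <-]; rewrite lerBlDr.
  apply: (@le_trans _ _ (mdist x y + dist_to_set y D)); last first.
    by rewrite lerD2l; exact: BD.
  rewrite -lerBlDl; apply: lb_le_inf; first exact: (dist_to_set_has_inf y D0).1.
  move=> _ [z Dz <-]; rewrite lerBlDl.
  apply: le_trans (dist_to_set_le _ Dz) _; exact: metric_triangle.
move=> X0 Y0 Z0; apply/hausdorff_distP => //; split; first exact: half.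
move=> z Zz.
rewrite addrC (hausdorff_dist_sym X) (hausdorff_dist_sym Y); exact: half.
Qed.

Lemma hausdorff_dist_eq0_subset X Y : X !=set0 -> Y !=set0 -> closed Y ->
  hausdorff_dist X Y = 0 -> X `<=` Y.
Proof.
move=> X0 Y0 cY XY0 x Xx; apply: cY => B.
rewrite -filter_from_ballE => -[e /= e0 eB].
have [/(_ _ Xx) + _] := (hausdorff_distP _ X0 Y0).1 (lexx _).
rewrite XY0 => xY.
have : inf [set mdist x y | y in Y] < e by exact: le_lt_trans e0.
move=> /(inf_lt (dist_to_set_has_inf x Y0).1) [_ [y Yy <-] ye].
by exists y; split => //; apply: eB; rewrite ballEmdist.
Qed.

Lemma hausdorff_dist_eq0 X Y : X !=set0 -> Y !=set0 ->
  closed X -> closed Y -> hausdorff_dist X Y = 0 -> X = Y.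
Proof.
move=> X0 Y0 cX cY XY0; apply/seteqP; split.
  exact: hausdorff_dist_eq0_subset.
by apply: hausdorff_dist_eq0_subset => //; rewrite hausdorff_dist_sym.
Qed.

End Bounded.
End HausdorffDistance.

(* [R] is a parameter only because the metric is [R]-valued. *)
Definition full_shift (R : realType) (A : finType) : Type := int -> A.

Section FullShift.
Context {R : realType} {A : finType}.
Local Notation AZ := (full_shift R A).
Implicit Types x y z : AZ.

(* The case [x = y] is the convention [2 ^ (- inf set0) = 2 ^ (- +oo) = 0]. *)
Definition full_shift_dist x y : R :=
  if `[< x = y >] then 0
  else 2 `^ (- inf [set `|n|%:~R | n in [set n : int | x n != y n]]).

Lemma full_shift_distP x y : x <> y ->
  exists n : int, [/\ full_shift_dist x y = 2 `^ (- `|n|%:~R),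
    x n != y n & forall m : int, x m != y m -> (`|n| <= `|m|)%R].
Proof.
move=> xy; rewrite /full_shift_dist asboolF//.
have /existsNP[n0 /eqP n0P] : ~ (forall n, x n = y n).
  by move=> h; apply: xy; apply/funext.
pose P := fun k : nat => `[< exists2 n : int, x n != y n & `|n|%N = k >].
have exP : exists k, P k by exists `|n0|%N; apply/asboolP; exists n0.
case: (ex_minnP exP) => _ /asboolP[n nP <-] nmin.
have le_n (m : int) : x m != y m -> (`|n| <= `|m|)%R.
  move=> mP; rewrite -!abszE lez_nat; apply: nmin; apply/asboolP.
  by exists m.
exists n; split => //; congr (_ `^ (- _)).
apply/le_anti/andP; split.
  apply: ge_inf; last by exists n.
  by exists 0 => _ [m _ <-]; rewrite ler0z.
apply: lb_le_inf; first by exists (`|n|%:~R), n.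
by move=> _ [m mP <-]; rewrite ler_int; exact: le_n.
Qed.

Lemma full_shift_dist_ge0 x y : 0 <= full_shift_dist x y.
Proof. by rewrite /full_shift_dist; case: ifP => // _; exact: powR_ge0. Qed.

Lemma full_shift_dist_le1 x y : full_shift_dist x y <= 1.
Proof.
have [->|/full_shift_distP[n [-> _ _]]] := pselect (x = y).
  by rewrite /full_shift_dist asboolT.
by rewrite -[leRHS](powRr0 2) ler_powR ?ler1n// oppr_le0 ler0z.
Qed.

Lemma full_shift_distxx x : full_shift_dist x x = 0.
Proof. by rewrite /full_shift_dist asboolT. Qed.

Lemma full_shift_dist_eq0 x y : full_shift_dist x y = 0 -> x = y.
Proof.
have [//|/full_shift_distP[n [-> _ _]]] := pselect (x = y).
by move=> /eqP; rewrite gt_eqF// powR_gt0.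
Qed.

Lemma full_shift_dist_sym x y : full_shift_dist x y = full_shift_dist y x.
Proof.
rewrite /full_shift_dist.
have -> : `[< x = y >] = `[< y = x >] by apply: asbool_equiv_eq; split.
by under eq_set do rewrite eq_sym.
Qed.

Lemma full_shift_dist_triangle y x z :
  full_shift_dist x z <= full_shift_dist x y + full_shift_dist y z.
Proof.
have le2 (u v : AZ) (m : int) : u m != v m ->
    2 `^ (- `|m|%:~R) <= full_shift_dist u v.
  move=> uvm; have : u <> v by move=> uv; rewrite uv eqxx in uvm.
  move=> /full_shift_distP[n [-> _ /(_ _ uvm) nm]].
  by rewrite ler_powR ?ler1n// lerN2 ler_int.
have [->|/full_shift_distP[n [-> xzn _]]] := pselect (x = z).
  by rewrite full_shift_distxx addr_ge0// full_shift_dist_ge0.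
have [xyn|xyn] := eqVneq (x n) (y n).
  rewrite xyn in xzn; apply: le_trans (le2 _ _ _ xzn) _.
  by rewrite lerDr full_shift_dist_ge0.
by apply: le_trans (le2 _ _ _ xyn) _; rewrite lerDl full_shift_dist_ge0.
Qed.

HB.instance Definition _ := gen_eqMixin AZ.
HB.instance Definition _ := gen_choiceMixin AZ.
HB.instance Definition _ := @isMetric.Build R AZ full_shift_dist
  full_shift_distxx full_shift_dist_eq0 full_shift_dist_sym
  full_shift_dist_triangle.

Definition shift_map x : AZ := fun n => x (n + 1).

(* The word [w] is [x_i ... x_(i + size w - 1)] for some [i]. *)
Definition occurs_in (w : seq A) x :=
  exists i : int, w = mkseq (fun k => x (i + k%:Z)) (size w).

Definition occurs (w : seq A) (X : set AZ) := exists2 x, X x & occurs_in w x.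

Definition minimal_forbidden (X : set AZ) (w : seq A) :=
  ~ occurs w X /\ forall u : seq A, infix u w -> u != w -> occurs u X.

Definition language (X : set AZ) (n : nat) : set (n.-tuple A) :=
  [set w | occurs w X].
Arguments language X n _ : clear implicits.

Definition htop (X : set AZ) : R :=
  limn (fun n : nat => n%:R^-1 * ln #|language X n|%:R).

End FullShift.
Arguments language {R A} X n _.

Record subshift (R : realType) (A : finType) := Subshift {
  subshift_set :> set (full_shift R A);
  subshift_nonempty : subshift_set !=set0;
  subshift_closed : closed subshift_set;
  subshift_invariant : shift_map @` subshift_set = subshift_set }.

Section SubshiftSpace.
Context {R : realType} {A : finType}.
Implicit Types X Y Z : subshift R A.

Let mdist_le1 (x y : full_shift R A) : mdist x y <= 1.
Proof. exact: full_shift_dist_le1. Qed.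

Definition subshift_dist X Y : R := hausdorff_dist X Y.

Lemma subshift_distxx X : subshift_dist X X = 0.
Proof. exact: hausdorff_distxx mdist_le1 _ (subshift_nonempty X). Qed.

Lemma subshift_inj X Y : X = Y :> set (full_shift R A) -> X = Y.
Proof.
case: X Y => [X ? ? ?] [Y ? ? ?] /= XY; subst Y.
by congr Subshift; exact: Prop_irrelevance.
Qed.

Lemma subshift_dist_eq0 X Y : subshift_dist X Y = 0 -> X = Y.
Proof.
move=> XY0; apply: subshift_inj; apply: (hausdorff_dist_eq0 mdist_le1) XY0;
  by [exact: subshift_nonempty | exact: subshift_closed].
Qed.

Lemma subshift_dist_sym X Y : subshift_dist X Y = subshift_dist Y X.
Proof. exact: hausdorff_dist_sym. Qed.

Lemma subshift_dist_triangle Y X Z :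
  subshift_dist X Z <= subshift_dist X Y + subshift_dist Y Z.
Proof.
by apply: (hausdorff_dist_triangle mdist_le1); exact: subshift_nonempty.
Qed.

HB.instance Definition _ := gen_eqMixin (subshift R A).
HB.instance Definition _ := gen_choiceMixin (subshift R A).
HB.instance Definition _ := @isMetric.Build R (subshift R A) subshift_dist
  subshift_distxx subshift_dist_eq0 subshift_dist_sym subshift_dist_triangle.

(* The class Z(a_n), for shifts over the alphabet [A]. *)
Definition gap_class (a_ : nat -> nat) : set (subshift R A) :=
  [set X | infinite_set [set n : nat | forall w : seq A,
     (n <= size w <= n + a_ n)%N -> ~ minimal_forbidden X w]].

End SubshiftSpace.

(* For [a <= m], a subshift of {0, ..., a - 1}^Z is a subshift over ['I_m] whose
   letters are all below [a]. *)
Definition letters_below {R : realType} {m : nat} (a : nat) :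
    set (subshift R 'I_m) :=
  [set Y : subshift R 'I_m |
    language Y 1 `<=` [set w : 1.-tuple 'I_m | (thead w < a)%N]].

Definition subshifts_entropy_ge {R : realType} {m : nat} (a : nat) (h : R) :
    set (subshift R 'I_m) :=
  [set Y : subshift R 'I_m | letters_below a Y /\ h <= htop Y].

Definition T_ {R : realType} {m : nat} (a_ : nat -> nat) (a : nat) (h : R) :
    set (subshift R 'I_m) :=
  [set Y : subshift R 'I_m | [/\ gap_class a_ Y, letters_below a Y & h <= htop Y]].

(* Main.v *)
Require Import Defs.
From HB Require Import structures.
From mathcomp Require Import all_boot all_order all_algebra.
From mathcomp Require Import all_classical all_reals all_analysis borel_hierarchy.
From mathcomp Require Import zify ring.
Set Implicit Arguments.
Unset Strict Implicit.
Unset Printing Implicit Defensive.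
Import Order.TTheory GRing.Theory Num.Theory.
Import numFieldNormedType.Exports.
Local Open Scope classical_set_scope.
Local Open Scope ring_scope.

(** Two subshifts are close in the Hausdorff metric exactly when they have the
same words up to a large length: a distance below [2 ^ (- n)] forces agreement
on the words of length at most [n + 1], and agreement on the words of length
[2 n + 1] forces a distance at most [2 ^ (- n)].

For the G_delta part, whether a word of length at most [p] is a minimal
forbidden word depends only on the words of length at most [p]. Hence having no
minimal forbidden word of length between [n] and [p] is an open condition
([no_minimal_forbidden_open]), and holding for infinitely many [n] is a
countable intersection of unions of such conditions ([gap_class_bigcap]).

For density, a subshift [X] is approximated by its Markov approximations: the
sequences all of whose words of length [n] are words of [X].  They converge to
[X] because they have the same words up to length [n].  They have no minimal
forbidden word longer than [n], because two words of length at least [n]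
overlapping in at least [n - 1] letters can be glued
([markov_set_no_minimal_forbidden]); so they lie in the gap class for every
sequence of gap lengths.  As they contain [X], their entropy is not smaller
([htop_le]); and they have the letters of [X] as soon as [n] is positive.
Comparing entropies requires that the limits defining them exist, which is
Fekete's subadditive lemma ([subadditive_mean_cvg]). *)

(** * Fekete's lemma *)

Section Fekete.
Variable R : realType.

(** The limit is the infimum of the means: if the mean at [k + 1] is nearly the
infimum, dividing [n] by [k + 1] bounds [u n] by about [n] times that mean, up
to the value of [u] at a remainder, which is bounded. *)
Lemma subadditive_mean_cvg (u : nat -> R) :
    (forall n, 0 <= u n) -> (forall p q, u (p + q)%N <= u p + u q) ->
  cvgn (fun n => n%:R^-1 * u n).
Proof.
move=> u0 uD; pose S := [set k.+1%:R^-1 * u k.+1 | k in [set: nat]].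
have S0 : has_inf S.
  split; first by exists (1%:R^-1 * u 1%N), 0%N.
  by exists 0 => _ [k _ <-]; rewrite mulr_ge0// invr_ge0.
apply/cvg_ex; exists (inf S); apply/cvgrPdist_le => e e0.
have [_ [k _ <-] lk] := inf_adherent (divr_gt0 e0 (ltr0n R 2)) S0.
(* A bound for [u] at all remainders modulo [k + 1]. *)
pose M := \sum_(r < k.+1) u r.
have uq q r : u (q * k.+1 + r)%N <= q%:R * u k.+1 + u r.
  elim: q => [|q IH]; first by rewrite mul0n mul0r add0n add0r.
  rewrite mulSn -addnA -natr1 mulrDl mul1r addrAC [leRHS]addrC.
  by apply: le_trans (uD _ _) _; rewrite lerD2l.
near=> n.
have n0 : (0 < n)%N by near: n; exists 1%N.
have nR : 0 < n%:R :> R by rewrite ltr0n.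
have lb : inf S <= n%:R^-1 * u n.
  by apply: (ge_inf S0.2); exists n.-1 => //; rewrite prednK.
rewrite ler0_norm ?subr_le0// opprB lerBlDr.
have Mn : M <= e / 2 * n%:R.
  by rewrite mulrC -ler_pdivrMr ?divr_gt0//; near: n; exact: nbhs_infty_ger.
have uM : u n <= n%:R * (k.+1%:R^-1 * u k.+1) + M.
  rewrite {1}(divn_eq n k.+1); apply: le_trans (uq _ _) _.
  apply: lerD; last first.
    have lt_r : (n %% k.+1 < k.+1)%N by rewrite ltn_mod.
    by rewrite /M (bigD1 (Ordinal lt_r))//= lerDl sumr_ge0.
  rewrite mulrA ler_wpM2r// ler_pdivlMr ?ltr0n// -natrM ler_nat.
  exact: leq_trunc_div.
rewrite mulrC ler_pdivrMr//; apply: le_trans uM _.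
have -> : (e + inf S) * n%:R = n%:R * (inf S + e / 2) + e / 2 * n%:R.
  by field.
by apply: lerD => //; rewrite ler_wpM2l// ltW.
Unshelve. all: by end_near.
Qed.

End Fekete.

(** * Words, distances and Markov approximations *)

Section Words.
Context {R : realType} {A : finType}.
Local Notation AZ := (full_shift R A).
Implicit Types (x y z : AZ) (X Y : set AZ) (w u : seq A) (i j : int).

Definition window x i n : seq A := mkseq (fun k => x (i + k%:Z)) n.

Lemma size_window x i n : size (window x i n) = n.
Proof. exact: size_mkseq. Qed.

Lemma window_cat x i p q :
  window x i (p + q) = window x i p ++ window x (i + p%:Z) q.
Proof.
rewrite /window /mkseq iotaD map_cat add0n; congr (_ ++ _).
rewrite -[p in iota p]addn0 iotaDl -map_comp; apply: eq_map => k /=.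
by rewrite PoszD addrA.
Qed.

Lemma eq_window x y i j n :
    (forall k, (k < n)%N -> x (i + k%:Z) = y (j + k%:Z)) ->
  window x i n = window y j n.
Proof.
move=> xy; apply: (@eq_from_nth _ (x 0)); rewrite !size_window// => k kn.
by rewrite !nth_mkseq// xy.
Qed.

Lemma occurs_window X x i n : X x -> occurs (window x i n) X.
Proof. by move=> Xx; exists x => //; exists i; rewrite size_window. Qed.

Lemma occurs_infix X w u : infix u w -> occurs w X -> occurs u X.
Proof.
move=> /infixP[s [s' ->]] [x Xx [i]].
rewrite !size_cat -/(window _ _ _) !window_cat => /eqP.
rewrite eqseq_cat ?size_window// => /andP[_].
rewrite eqseq_cat ?size_window// => /andP[/eqP -> _].
exact: occurs_window.
Qed.

Lemma sub_occurs X Y w : X `<=` Y -> occurs w X -> occurs w Y.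
Proof. by move=> XY [x Xx xw]; exists x => //; exact: XY. Qed.

Lemma agree_mdist_lt n x y : mdist x y < 2 `^ (- n%:R) ->
  forall i, (`|i| <= n)%N -> x i = y i.
Proof.
have [->//|xy] := pselect (x = y).
move: (full_shift_distP xy) => [k [xyk _ kmin]].
rewrite [mdist x y]xyk => lt_n i le_i; apply/eqP/negPn/negP => /kmin.
rewrite -!abszE lez_nat => le_ki; move: lt_n; rewrite ltNge => /negP; apply.
rewrite ler_powR ?ler1n// lerN2 -abszE -pmulrn ler_nat.
exact: leq_trans le_i.
Qed.

Lemma mdist_le_agree n x y : (forall i, (`|i| <= n)%N -> x i = y i) ->
  mdist x y <= 2 `^ (- n%:R).
Proof.
move=> xy_n; have [->|xy] := pselect (x = y).
  by rewrite mdistxx powR_ge0.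
move: (full_shift_distP xy) => [k [xyk /eqP xk kmin]].
rewrite [mdist x y]xyk ler_powR ?ler1n// lerN2 -abszE -pmulrn ler_nat.
by rewrite ltnW// ltnNge; apply/negP => /xy_n.
Qed.

(** The shift of finite type, or [n]-step Markov approximation, obtained by
forbidding the words of length [n] that [X] avoids. *)
Definition markov_set n X : set AZ :=
  [set x | forall i, occurs (window x i n) X].

Lemma sub_markov_set n X : X `<=` markov_set n X.
Proof. by move=> x Xx i; exact: occurs_window. Qed.

(** A word of length at most [n] extends to a window of length [n], so the two
languages agree up to that length. *)
Lemma occurs_markov_set n X w : (0 < n)%N -> (size w <= n)%N ->
  occurs w (markov_set n X) <-> occurs w X.
Proof.
move=> n0 wn; split; last exact/sub_occurs/sub_markov_set.
move=> [x xM [i wE]]; apply: occurs_infix (xM i).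
rewrite wE -/(window x i _) -(subnKC wn) window_cat.
exact: prefix_infix.
Qed.

(** A window of length [n] at [i] is read inside the ball of indices of radius
[|i| + n], so it is shared with a nearby point. *)
Lemma markov_set_closed n X : closed (markov_set n X).
Proof.
move=> x xM i.
have e0 : 0 < 2 `^ (- (`|i| + n)%:R) :> R by rewrite powR_gt0.
have [y [yM]] := xM _ (nbhsx_ballx x _ e0).
rewrite ballEmdist /= => /agree_mdist_lt xy.
rewrite (@eq_window x y i i n)// => k kn; apply: xy.
by lia.
Qed.

Lemma markov_set_invariant n X : shift_map @` markov_set n X = markov_set n X.
Proof.
apply/seteqP; split => [_ [x xM <-] i|x xM].
  rewrite (@eq_window _ x i (i + 1) n); first exact: xM.
  by move=> k _; rewrite /shift_map addrAC.
exists (fun i => x (i - 1)); last by apply/funext => i; rewrite /shift_map addrK.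
move=> i; rewrite (@eq_window _ x i (i - 1) n); first exact: xM.
by move=> k _; rewrite addrAC.
Qed.

Lemma occurs_nth X w d : occurs w X ->
  exists2 x, X x &
    exists i, forall k, (k < size w)%N -> nth d w k = x (i + k%:Z).
Proof.
move=> [x Xx [i ->]]; exists x => //; exists i => k; rewrite size_mkseq.
exact: nth_mkseq.
Qed.

(** If both maximal proper subwords of [w] occur, one in [x] and one in [y], the
left half of [x] and the right half of [y] glue along their common middle part.
A window of length [n] of the result does not meet both the first and the last
letter of [w], so it is already a window of [x] or of [y]; hence [w] occurs. *)
Lemma markov_set_no_minimal_forbidden n X w : (0 < n)%N ->
  (n < size w)%N -> ~ minimal_forbidden (markov_set n X) w.
Proof.
move=> n0 nw [wN wP]; apply: wN.
have [d _] : {d : A & True} by case: w {wP} nw => [//|d w _]; exists d.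
set p := (size w).-1; have pE : size w = p.+1 by rewrite /p; lia.
have sz u : size u = p -> u != w.
  by move=> up; apply/eqP => uw; move: up; rewrite uw pE => /eqP; rewrite gtn_eqF.
have size_l : size (take p w) = p by rewrite size_takel ?pE.
have size_r : size (drop 1 w) = p by rewrite size_drop pE subn1.
have [x xM [i xw]] := occurs_nth d (wP _ (infix_take _ _) (sz _ size_l)).
have [y yM [j yw]] := occurs_nth d (wP _ (infix_drop _ _) (sz _ size_r)).
(* Shift the origin so that [w] is read from index [0] on, in [x] at [i] and in
   [y] at [j - 1], since [drop 1 w] starts one letter later. *)
have {}xw (k : int) : (0 <= k)%R -> (k < p%:Z)%R -> nth d w `|k|%N = x (i + k).
  move=> k0 kp; have := xw `|k|%N; rewrite size_l nth_take; last by lia.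
  by rewrite gez0_abs//; apply; lia.
have {}yw (k : int) :
  (0 < k)%R -> (k <= p%:Z)%R -> nth d w `|k|%N = y (j - 1 + k).
  move=> k0 kp; have := yw (`|k|%N.-1); rewrite size_r nth_drop.
  have -> : (1 + `|k|.-1 = `|k|)%N by lia.
  have -> : (j + `|k|%N.-1%:Z = j - 1 + k)%R by lia.
  by apply; lia.
pose z : AZ := fun k =>
  if (k < p%:Z)%R then x (i + k) else y (j - 1 + k).
have zx k : (k < p%:Z)%R -> z k = x (i + k) by rewrite /z => ->.
have zy k : (0 < k)%R -> z k = y (j - 1 + k).
  by move=> k0; rewrite /z; case: ifP => // kp; rewrite -xw ?yw// ltW.
exists z.
  move=> l; have [ln|ln] := leP (l + n%:Z)%R (p%:Z)%R.
    rewrite (@eq_window _ x l (i + l) n); first exact: xM.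
    by move=> k kn; rewrite zx ?addrA//; lia.
  rewrite (@eq_window _ y l (j - 1 + l) n); first exact: yM.
  by move=> k kn; rewrite zy ?addrA//; lia.
exists 0; apply: (@eq_from_nth _ d) => [|k kw]; first by rewrite size_mkseq.
rewrite nth_mkseq// add0r /z; case: ifP => kp; first by rewrite -xw.
by rewrite -yw//; lia.
Qed.

End Words.

(** * Monotonicity of entropy *)

Section Entropy.
Context {R : realType} {A : finType}.
Implicit Types (X Y : subshift R A).

Lemma language_card_gt0 X n : (0 < #|language X n|)%N.
Proof.
have [x Xx] := subshift_nonempty X; apply/card_gt0P.
exists (Tuple (introT eqP (size_window x 0 n))).
by rewrite inE; exact: occurs_window.
Qed.

(** Cutting a word of length [p + q] after [p] letters is injective. *)
Lemma language_card_add X p q :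
  (#|language X (p + q)| <= #|language X p| * #|language X q|)%N.
Proof.
have sp (w : (p + q).-tuple A) : size (take p w) = p.
  by rewrite size_takel// size_tuple leq_addr.
have sq (w : (p + q).-tuple A) : size (drop p w) = q.
  by rewrite size_drop size_tuple addKn.
pose f (w : (p + q).-tuple A) :=
    (Tuple (introT eqP (sp w)), Tuple (introT eqP (sq w))).
rewrite -cardX -(@card_in_imset _ _ f); last first.
  move=> w w' _ _ [ep eq].
  by apply/val_inj; rewrite /= -[LHS](cat_take_drop p) ep eq cat_take_drop.
apply/subset_leq_card/fintype.subsetP => _ /imsetP[w + ->].
rewrite inE => wX; apply/andP; split; apply/mem_set => /=.
  exact/(occurs_infix (infix_take _ _)).
exact/(occurs_infix (infix_drop _ _)).
Qed.

Lemma htop_cvg X : cvgn (fun n => n%:R^-1 * ln #|language X n|%:R : R).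
Proof.
have pos n : (#|language X n|%:R : R) \is Num.pos.
  by rewrite posrE ltr0n language_card_gt0.
apply: subadditive_mean_cvg => [n|p q].
  by rewrite ln_ge0// ler1n language_card_gt0.
rewrite -lnM// -natrM ler_ln ?posrE ?ltr0n ?muln_gt0 ?language_card_gt0//.
by rewrite ler_nat language_card_add.
Qed.

Lemma htop_le X Y : X `<=` Y -> htop X <= htop Y.
Proof.
move=> XY; apply: ler_lim; [exact: htop_cvg|exact: htop_cvg|].
apply: nearW => n; rewrite ler_wpM2l ?invr_ge0//.
rewrite ler_ln ?posrE ?ltr0n ?language_card_gt0// ler_nat.
apply/subset_leq_card/fintype.subsetP => w; rewrite !inE.
exact: sub_occurs.
Qed.

End Entropy.

(** * Hausdorff distance and languages *)

Section Metric.
Context {R : realType} {A : finType}.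
Implicit Types (X Y : subshift R A) (w : seq A).

Lemma subshift_translate X (x : full_shift R A) (j : int) :
  subshift_set X x -> subshift_set X (fun i => x (i + j)).
Proof.
have step (y : full_shift R A) : subshift_set X y -> subshift_set X (fun i => y (i + 1)).
  by move=> Xy; rewrite -subshift_invariant; exists y.
have back (y : full_shift R A) : subshift_set X y -> subshift_set X (fun i => y (i - 1)).
  rewrite -{1}subshift_invariant => -[z Xz <-]; congr (subshift_set X _): Xz.
  by apply/funext => i; rewrite /shift_map subrK.
move=> Xx; elim/int_rect: j => [|n IH|n IH].
- by congr (subshift_set X _): Xx; apply/funext => i; rewrite addr0.
- congr (subshift_set X _): (step _ IH); apply/funext => i.
  by rewrite -addrA; congr (x (_ + _)); lia.
- congr (subshift_set X _): (back _ IH); apply/funext => i.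
  by rewrite -addrA; congr (x (_ + _)); lia.
Qed.

(** By shift invariance, words can be read at any prescribed position, in
particular near the origin, where the metric sees them. *)
Lemma occurs_at X w i : occurs w X ->
  exists2 x, subshift_set X x & w = window x i (size w).
Proof.
move=> [x Xx [j wE]]; exists (fun k => x (k + (j - i))).
  exact: subshift_translate.
by rewrite {1}wE; apply: eq_window => k _; congr (x _); lia.
Qed.

Lemma full_shift_mdist_le1 (x y : full_shift R A) : mdist x y <= 1.
Proof. exact: full_shift_dist_le1. Qed.

(** Distance below [2 ^ (- n)] gives agreement at the indices [0], ..., [n], hence
the length [n + 1]. *)
Lemma occurs_of_subshift_dist_lt n X Y : mdist X Y < 2 `^ (- n%:R) ->
  forall w, (size w <= n.+1)%N -> occurs w X -> occurs w Y.
Proof.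
move=> XY w wn /(@occurs_at _ _ 0)[x Xx ->].
have X0 := subshift_nonempty X; have Y0 := subshift_nonempty Y.
have [/(_ _ Xx) xY _] :=
  (hausdorff_distP full_shift_mdist_le1 _ X0 Y0).1 (lexx _).
have /inf_lt := le_lt_trans xY XY.
move=> /(_ (dist_to_set_has_inf x Y0).1)[_ [y Yy <-] /agree_mdist_lt xy].
rewrite (@eq_window _ _ x y 0 0)// => [|k kw]; first exact: occurs_window.
by rewrite add0r xy//; lia.
Qed.

(** The words of length [2 n + 1] are those read on the index interval centred at
the origin that a ball of radius [2 ^ (- n)] controls. *)
Lemma subshift_dist_le_of_occurs n X Y :
  (forall w, size w = n.*2.+1 -> occurs w X <-> occurs w Y) ->
  mdist X Y <= 2 `^ (- n%:R).
Proof.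
have half (Z T : subshift R A) :
    (forall w, size w = n.*2.+1 -> occurs w Z -> occurs w T) ->
    forall x, subshift_set Z x -> dist_to_set x T <= 2 `^ (- n%:R).
  move=> ZT x Zx.
  have := ZT (window x (- n%:Z) n.*2.+1) (size_window _ _ _)
             (occurs_window _ _ Zx).
  move=> /(@occurs_at _ _ (- n%:Z))[y Ty]; rewrite size_window => xy.
  apply: le_trans (dist_to_set_le _ Ty) (mdist_le_agree _) => i i_le.
  have kn : (`|(i + n%:Z)%R| < n.*2.+1)%N by lia.
  have := congr1 (fun s => nth (x 0) s `|(i + n%:Z)%R|%N) xy.
  by rewrite !nth_mkseq// (_ : - n%:Z + `|(i + n%:Z)%R|%N%:Z = i)//; lia.
have X0 := subshift_nonempty X; have Y0 := subshift_nonempty Y.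
move=> XY; apply/(hausdorff_distP full_shift_mdist_le1 _ X0 Y0).
by split; apply: half => w /XY[].
Qed.

Definition markov_approx n X : subshift R A := Subshift
  (subset_nonempty (@sub_markov_set _ _ n X) (subshift_nonempty X))
  (@markov_set_closed _ _ n X) (markov_set_invariant n X).

Lemma mdist_markov_approx n X :
  mdist X (markov_approx n.*2.+1 X) <= 2 `^ (- n%:R).
Proof.
by apply: subshift_dist_le_of_occurs => w wn; rewrite occurs_markov_set ?wn.
Qed.

Definition no_minimal_forbidden n p : set (subshift R A) :=
  [set X | forall w, (n <= size w <= p)%N -> ~ minimal_forbidden X w].

(** Being a minimal forbidden word [w] involves only [w] and its subwords, and all
subshifts at distance below [2 ^ (- p)] have the same words of length at most
[p]. *)
Lemma no_minimal_forbidden_open n p : open (no_minimal_forbidden n p).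
Proof.
rewrite openE => X XP; apply/nbhs_ballP; exists (2 `^ (- p%:R)) => /=.
  by rewrite powR_gt0.
move=> Y; rewrite ballEmdist /= => XY w wp [wN wsub]; apply: (XP w wp).
have YX : mdist Y X < 2 `^ (- p%:R) by rewrite metric_sym.
have wp1 : (size w <= p.+1)%N by lia.
split=> [wX|u uw ne_uw]; first exact/wN/(occurs_of_subshift_dist_lt XY).
apply: (occurs_of_subshift_dist_lt YX); last exact: wsub.
exact: leq_trans (size_infix uw) _.
Qed.

Lemma infinite_set_natP (S : set nat) :
  infinite_set S <-> forall n, exists2 k, (n <= k)%N & S k.
Proof.
split=> [Sinf n|Sub].
  apply: contrapT => Sn; apply: Sinf.
  apply: sub_finite_set (finite_II n) => k Sk /=.
  by rewrite ltnNge; apply/negP => nk; apply: Sn; exists k.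
move=> /finite_seqP[s sE]; have [k + Sk] := Sub (\max_(i <- s) i).+1.
by rewrite ltnNge => /negP; apply; rewrite leq_bigmax_seq//; move: Sk; rewrite sE.
Qed.

Lemma gap_class_bigcap (a_ : nat -> nat) :
  gap_class a_ = \bigcap_N \bigcup_(n in [set n | (N <= n)%N])
    no_minimal_forbidden n (n + a_ n) :> set (subshift R A).
Proof.
apply/seteqP; split=> X.
  by move=> /infinite_set_natP XP N _; have [n ? ?] := XP N; exists n.
by move=> XP; apply/infinite_set_natP => N; have [n ? ?] := XP N I; exists n.
Qed.

Lemma markov_approx_gap_class (a_ : nat -> nat) n X : (0 < n)%N ->
  gap_class a_ (markov_approx n X).
Proof.
move=> n0; apply/infinite_set_natP => N.
exists (maxn N n.+1); first exact: leq_maxl.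
move=> w /andP[nw _]; apply: markov_set_no_minimal_forbidden => //.
exact: leq_trans (leq_maxr _ _) nw.
Qed.

End Metric.

(** * Density and the G_delta property *)

(* [space], used as a type, carries the metric topology induced by the Hausdorff
   distance on [subshift R 'I_m]. *)
Theorem proposition4p14 (R : realType) (a_ : nat -> nat)
    (a_gt0 : forall n, (0 < a_ n)%N) (a : nat) (a_pos : (0 < a)%N)
    (m : nat) (le_am : (a <= m)%N)
    (h : R) (h_ge0 : 0 <= h) (h_le : h <= ln a%:R) :
  let space : set (subshift R 'I_m) := subshifts_entropy_ge a h in
  let T_in_space : set space := set_val @^-1` T_ a_ a h in
  dense T_in_space /\ Gdelta T_in_space.
Proof.
move=> space T_in_space; split; last first.
  (* The conditions on letters and entropy hold throughout [space], so only the
     gap class has to be written as a countable intersection. *)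
  exists (fun N => set_val @^-1`
    (\bigcup_(n in [set n | (N <= n)%N]) no_minimal_forbidden n (n + a_ n))).
    move=> N; apply: open_comp; first by move=> Y _; exact: initial_continuous.
    by apply: bigcup_open => n _; exact: no_minimal_forbidden_open.
  rewrite -preimage_bigcap -gap_class_bigcap; apply/seteqP; split=> Y.
    by case.
  by have [Yl Yh] := set_valP Y.
move=> O [Y OY] oO; have [Yl Yh] := set_valP Y.
case: oO => V oV VO.
move: OY; rewrite -VO /= => VY; move: oV; rewrite openE => /(_ _ VY).
move=> /nbhs_ballP[e /= e0 eV].
have [n ne] : exists n : nat, 2 `^ (- n%:R) < e.
  have [n _ /(_ _ (leqnn n)) ne] := near_infty_natSinv_lt (PosNum e0).
  exists n; apply: le_lt_trans ne.
  rewrite powRN powR_mulrn// lef_pV2 ?posrE ?exprn_gt0// -natrX ler_nat.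
  exact: ltn_expl.
pose Z := markov_approx n.*2.+1 (set_val Y).
have ZV : V Z.
  apply: eV; rewrite ballEmdist /=.
  exact: le_lt_trans (mdist_markov_approx _ _) ne.
have Zl : letters_below a Z.
  move=> w wZ; apply: Yl; apply/(occurs_markov_set _ _ _).1: wZ => //.
  by rewrite size_tuple.
have Zh : h <= htop Z by apply: (le_trans Yh); apply: htop_le; exact: sub_markov_set.
have Zs : Z \in space by rewrite inE.
exists (exist _ Z Zs); split => //=; split=> //.
exact: markov_approx_gap_class.
Qed.
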